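(* Assume that there exists a torsion free amenable group $H$ and a field $k$ such that the group algebra $kH$ is not a domain. Then there is a finitely generated torsion free amenable group $G$ such that the group algebra $kG$ has infinite uniform dimension.
   Context: Here $k$ denotes an arbitrary field. A group $G$ is amenable if there is a map $\mu$ from the set of subsets of $G$ to $[0,1]$ with $\mu(G)=1$, $\mu(A\cup B)=\mu(A)+\mu(B)$ for all subsets $A,B\subseteq G$ with $A\cap B=\emptyset$, and $\mu(A)=\mu(gA)=\mu(Ag)$ for all $A\subseteq G$ and $g\in G$. A right module $M$ over a ring $R$ has finite uniform dimension if it contains no infinite direct sum of non-zero submodules; otherwise it has infinite uniform dimension. The uniform dimension of a group algebra $kG$ is that of $kG$ as a right module over itself (for group algebras the right and left uniform dimensions are equal). *)

(* Defs.v *)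
From HB Require Import structures.
From mathcomp.multinomials Require Import monalg.
From mathcomp Require Import all_boot all_algebra finmap.
From mathcomp Require Import boolp classical_sets reals.

Set Implicit Arguments.
Unset Strict Implicit.
Unset Printing Implicit Defensive.

Import GRing.Theory.

Local Open Scope ring_scope.

(* Multinomials puts a ring structure on {malg k[G]} only for monoids in which
   x * y = 1 forces x = y = 1. For groups we keep its type of finitely supported
   functions and its additive structure, and define the convolution product on
   an alias. *)
Definition group_algebra (k : fieldType) (G : groupType) : Type :=
  {malg k[G]}.

HB.instance Definition _ (k : fieldType) (G : groupType) :=
  GRing.Lmodule.on (group_algebra k G).

Section GroupAlgebra.
Variables (k : fieldType) (G : groupType).
Implicit Types a b c : group_algebra k G.

Definition galg_one : group_algebra k G := << 1%g >>.

Definition galg_mul a b : group_algebra k G :=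
  \sum_(x <- msupp a) \sum_(y <- msupp b) << a@_x * b@_y *g (x * y)%g >>.

Lemma galg_mulw (d1 d2 : {fset G}) a b :
  (msupp a `<=` d1)%fset -> (msupp b `<=` d2)%fset ->
  galg_mul a b =
  \sum_(x <- d1) \sum_(y <- d2) << a@_x * b@_y *g (x * y)%g >>.
Proof.
move=> le_d1 le_d2; rewrite /galg_mul (big_fset_incl _ le_d1) /=.
  apply/eq_bigr=> x _; apply/big_fset_incl => // y _ /mcoeff_outdom ->.
  by rewrite mulr0 monalgU0.
move=> x _ /mcoeff_outdom ax.
by rewrite big1 // => y _; rewrite ax mul0r monalgU0.
Qed.

Lemma galg_mulUU r s x y :
  galg_mul << r *g x >> << s *g y >> = << r * s *g (x * y)%g >>.
Proof. by rewrite (galg_mulw msuppU_le msuppU_le) !big_seq_fset1 !mcoeffUU. Qed.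

Lemma galg_mulDl : left_distributive galg_mul +%R.
Proof.
move=> a b c.
rewrite [galg_mul a c](galg_mulw (fsubsetUl _ (msupp b)) (fsubset_refl _)).
rewrite [galg_mul b c](galg_mulw (fsubsetUr (msupp a) _) (fsubset_refl _)).
rewrite (galg_mulw (msuppD_le a b) (fsubset_refl _)).
rewrite -big_split /=; apply/eq_bigr=> x _.
rewrite -big_split /=; apply/eq_bigr=> y _.
by rewrite mcoeffD mulrDl monalgUD.
Qed.

Lemma galg_mulDr : right_distributive galg_mul +%R.
Proof.
move=> c a b.
rewrite [galg_mul c a](galg_mulw (fsubset_refl _) (fsubsetUl _ (msupp b))).
rewrite [galg_mul c b](galg_mulw (fsubset_refl _) (fsubsetUr (msupp a) _)).
rewrite (galg_mulw (fsubset_refl _) (msuppD_le a b)).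
rewrite -big_split /=; apply/eq_bigr=> x _.
rewrite -big_split /=; apply/eq_bigr=> y _.
by rewrite mcoeffD mulrDr monalgUD.
Qed.

Lemma galg_mul0l : left_zero 0 galg_mul.
Proof. by move=> a; rewrite /galg_mul msupp0 big_seq_fset0. Qed.

Lemma galg_mul0r : right_zero 0 galg_mul.
Proof.
by move=> a; rewrite /galg_mul msupp0 big1 // => x _; rewrite big_seq_fset0.
Qed.

Lemma galg_mul_suml I (s : seq I) (F : I -> group_algebra k G) b :
  galg_mul (\sum_(i <- s) F i) b = \sum_(i <- s) galg_mul (F i) b.
Proof.
exact: (big_morph (galg_mul^~ b) (fun _ _ => galg_mulDl _ _ _) (galg_mul0l _)).
Qed.

Lemma galg_mul_sumr I (s : seq I) (F : I -> group_algebra k G) a :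
  galg_mul a (\sum_(i <- s) F i) = \sum_(i <- s) galg_mul a (F i).
Proof.
exact: (big_morph (galg_mul a) (fun _ _ => galg_mulDr _ _ _) (galg_mul0r _)).
Qed.

Lemma galg_mulEl a b :
  galg_mul a b = \sum_(x <- msupp a) galg_mul << a@_x *g x >> b.
Proof. by rewrite {1}[a]monalgE galg_mul_suml. Qed.

Lemma galg_mulEr a b :
  galg_mul a b = \sum_(y <- msupp b) galg_mul a << b@_y *g y >>.
Proof. by rewrite {1}[b]monalgE galg_mul_sumr. Qed.

Lemma galg_mul1l : left_id galg_one galg_mul.
Proof.
move=> a; rewrite galg_mulEr [RHS]monalgE.
by apply/eq_bigr=> x _; rewrite galg_mulUU mul1r mul1g.
Qed.

Lemma galg_mul1r : right_id galg_one galg_mul.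
Proof.
move=> a; rewrite galg_mulEl [RHS]monalgE.
by apply/eq_bigr=> x _; rewrite galg_mulUU mulr1 mulg1.
Qed.

Lemma galg_mulA : associative galg_mul.
Proof.
move=> a b c; rewrite (galg_mulEl a (galg_mul b c)) (galg_mulEl a b).
rewrite (galg_mul_suml _ _ c); apply/eq_bigr=> x _.
rewrite (galg_mulEl b c) (galg_mulEr _ b) (galg_mul_suml _ _ c).
rewrite (galg_mul_sumr (msupp b)); apply/eq_bigr=> y _.
rewrite (galg_mulEr _ c) (galg_mul_sumr (msupp c)) [RHS]galg_mulEr.
by apply/eq_bigr=> z _; rewrite !galg_mulUU mulrA mulgA.
Qed.

Lemma galg_one_neq0 : galg_one != 0.
Proof. by apply/eqP/malgP=> /(_ 1%g) /eqP; rewrite !mcoeffsE oner_eq0. Qed.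

HB.instance Definition _ := GRing.Zmodule_isNzRing.Build (group_algebra k G)
  galg_mulA galg_mul1l galg_mul1r galg_mulDl galg_mulDr galg_one_neq0.

End GroupAlgebra.

Definition torsion_free (G : groupType) : Prop :=
  forall (x : G) (n : nat), (0 < n)%N -> (x ^+ n)%g = 1%g -> x = 1%g.

(* Some finite set lies in no proper subgroup. Taking subgroups to be boolean
   predicates is no restriction, given the classical axioms of boolp. *)
Definition finitely_generated (G : groupType) : Prop :=
  exists s : seq G, forall S : {pred G},
    group_closed S -> {subset s <= S} -> forall x, x \in S.

Definition amenable (R : realType) (G : groupType) : Prop :=
  exists mu : set G -> R,
    [/\ forall A, 0 <= mu A <= 1,
        mu setT = 1,
        forall A B, (A `&` B = set0)%classic ->
          mu (A `|` B)%classic = mu A + mu B,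
        forall A g, mu [set (g * x)%g | x in A]%classic = mu A &
        forall A g, mu [set (x * g)%g | x in A]%classic = mu A].

(* The axiom is stated in the library for all rings; it does not imply
   commutativity, and 1 != 0 holds in R : nzRingType. *)
Definition is_domain (R : nzRingType) : Prop := GRing.integral_domain_axiom R.

Section UniformDimension.
Variables (S : nzRingType) (M : lmodType S).

(* The sum of the submodules N i is direct. *)
Definition independent (N : nat -> {pred M}) : Prop :=
  forall (n : nat) (u : nat -> M), (forall i, u i \in N i) ->
    \sum_(i < n) u i = 0 -> forall i, (i < n)%N -> u i = 0.

(* An infinite direct sum contains a countably infinite one, so it is enough to
   index the summands by nat. *)
Definition infinite_uniform_dimension : Prop :=
  exists N : nat -> {pred M},
    [/\ forall i, GRing.submod_closed (N i),
        forall i, exists2 x, x \in N i & x != 0 &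
        independent N].

End UniformDimension.

(* A right R-module is a left module over the converse ring R^c; R as a right
   module over itself is R^c^o, where a *: x is the product x * a of R. *)
Definition infinite_right_uniform_dimension (R : nzRingType) : Prop :=
  @infinite_uniform_dimension R^c R^c^o.

(* Main.v *)
From HB Require Import structures.
Require Import Defs.
From mathcomp.multinomials Require Import monalg.
From mathcomp Require Import all_boot all_order all_algebra finmap.
From mathcomp Require Import boolp classical_sets reals.
From mathcomp Require Import filter topology normedtype.
From mathcomp Require Import lra.

(** Let [alpha * beta = 0] with [alpha, beta] nonzero in [kH].  The group [G] is
    a lamplighter-like subgroup of the wreath product of [H] by itself: it is
    generated by an element [top x0] of the top group, with [x0 <> 1], and by
    the elements [g] of the support of [alpha] placed at one position.  The
    conjugates of the latter by powers of [top x0] are copies of the support at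
    infinitely many positions, and copies at distinct positions commute.

    The heart of the matter is that finitely many copies already produce two
    nonzero right ideals with zero intersection.  Take as many positions as
    [alpha] has support elements.  If [T] is a nonempty set of positions,
    placing each [g] simultaneously at all the positions of [T] is an embedding
    of [H], so it sends [alpha] to an element that annihilates the image of
    [beta].  Suppose that, among the elements supported on the chosen
    positions, those with a nonzero right annihilator were stable under
    difference.  Then the elements
      [\sum_g alpha_g g^(e_0) \prod_s (g^(e_s) - h_s^(e_s))],
    where [g^(e)] is [g] placed at [e], would all have a nonzero right
    annihilator, since expanding one factor of the product expresses such an
    element by two with fewer factors ([mixed_cons], [mixed_annihilating]).
    But when the [h_s] run through all the support except [g_0], only the term
    of [g_0] survives, and it is a product of factors [x - y] with [x <> y]
    in a torsion free group: it is left regular ([mixed_regular]).  Hence there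
    are [z] and [w] with nonzero right annihilators such that [z - w] is left
    regular; if [z a = 0] and [w b = 0], then [a kU] and [b kU] meet trivially
    ([annihilators_disjoint], [disjoint_pair]).

    Doing this in disjoint blocks of positions gives pairs [a_n, b_n] that
    commute for distinct [n], and the right ideals generated by
    [b_0 ... b_(n-1) a_n] are independent ([staircase_independent]).

    It remains to see that [G] is amenable.  Integration turns the measure on
    [H] into a mean, that is, a positive normalised additive functional on
    bounded functions.  Means can be iterated, which gives means on the wreath
    product that are invariant under finitely many copies of [H]
    ([mean_extension]); a limit along an ultrafilter handles all copies at once
    ([mean_limit]), and one more iteration adds the top group.  A mean on a
    group that is invariant under a subgroup yields an invariant measure on
    this subgroup ([mean_amenable]). *)

Set Implicit Arguments.
Unset Strict Implicit.
Unset Printing Implicit Defensive.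

Import Order.TTheory GRing.Theory Num.Theory.
Import numFieldNormedType.Exports.

Local Open Scope classical_set_scope.
Local Open Scope ring_scope.

(** * Means and integration *)

Section Means.
Variable R : realType.

Definition bounded (X : Type) (f : X -> R) := exists M : R, forall x, `|f x| <= M.

(** The axiom on constants replaces homogeneity, which would otherwise have to
    be derived from additivity and monotonicity by rational approximation. *)
Record is_mean (X : Type) (m : (X -> R) -> R) : Prop := IsMean {
  meanD : forall f g, bounded f -> bounded g ->
    m (fun x => f x + g x) = m f + m g;
  mean_le : forall f g, bounded f -> bounded g ->
    (forall x, f x <= g x) -> m f <= m g;
  mean_cst : forall c, m (fun=> c) = c }.

Definition invariant_under (X : Type) (m : (X -> R) -> R) (tau : X -> X) :=
  forall f, bounded f -> m (fun x => f (tau x)) = m f.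

Lemma bounded_cst X c : bounded (fun _ : X => c).
Proof. by exists `|c|. Qed.

Lemma bounded_comp X Y (h : Y -> X) f : bounded f -> bounded (fun y => f (h y)).
Proof. by move=> [M fM]; exists M. Qed.

Lemma boundedD X (f g : X -> R) :
  bounded f -> bounded g -> bounded (fun x => f x + g x).
Proof.
move=> [M fM] [N gN]; exists (M + N) => x.
by apply: le_trans (ler_normD _ _) _; apply: lerD.
Qed.

Lemma boundedN X (f : X -> R) : bounded f -> bounded (fun x => - f x).
Proof. by move=> [M fM]; exists M => x; rewrite normrN. Qed.

Lemma mean_norm X (m : (X -> R) -> R) f M :
  is_mean m -> (forall x, `|f x| <= M) -> `|m f| <= M.
Proof.
move=> mP fM; have bf : bounded f by exists M.
have le x : - M <= f x <= M by rewrite -ler_norml.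
rewrite ler_norml; apply/andP; split.
  rewrite -{1}(mean_cst mP (- M)); apply: (mean_le mP) => //.
    exact: bounded_cst.
  by move=> x; case/andP: (le x).
rewrite -{1}(mean_cst mP M); apply: (mean_le mP) => //.
  exact: bounded_cst.
by move=> x; case/andP: (le x).
Qed.

Section Integral.
Variables (X : Type) (mu : set X -> R).
Hypothesis mu01 : forall A, 0 <= mu A <= 1.
Hypothesis muT : mu setT = 1.
Hypothesis muU : forall A B, (A `&` B = set0)%classic ->
  mu (A `|` B)%classic = mu A + mu B.

Definition step (l : seq (R * set X)) (x : X) : R :=
  \sum_(p <- l) if x \in p.2 then p.1 else 0.

Definition step_integral (l : seq (R * set X)) : R :=
  \sum_(p <- l) p.1 * mu p.2.

Let mu_ge0 A : 0 <= mu A. Proof. by case/andP: (mu01 A). Qed.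

Let mu0 : mu set0 = 0.
Proof.
have := muU (set0I set0); rewrite setU0 => /esym/eqP.
by rewrite -subr_eq0 addrK => /eqP.
Qed.

(** Positivity of the integral of step functions, relativised to [B] so that one
    can induct on the list of steps: the first step splits [B] in two parts, and
    is constant on both. *)
Lemma step_integral_ge_on l (B : set X) c :
  (forall x, x \in B -> c <= step l x) ->
  c * mu B <= \sum_(p <- l) p.1 * mu (B `&` p.2)%classic.
Proof.
rewrite /step; elim: l B c => [|[d A] l IHl] B c.
  rewrite big_nil => le_c; have [->|/set0P[x Bx]] := eqVneq B set0.
    by rewrite mu0 mulr0.
  apply: mulr_le0_ge0 => //.
  by have := le_c x (mem_set Bx); rewrite big_nil.
move=> le_c; rewrite big_cons /=.
have split_mu C : mu (B `&` C)%classic =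
    mu (B `&` A `&` C)%classic + mu ((B `\` A) `&` C)%classic.
  rewrite -muU; last first.
    by rewrite -subset0 => x [[[_ Ax] _] [[_ nAx] _]].
  by rewrite -setIUl setUIDK.
have splitB : mu B = mu (B `&` A)%classic + mu (B `\` A)%classic.
  by have := split_mu setT; rewrite !setIT.
rewrite splitB mulrDr.
have /IHl leA x : x \in (B `&` A)%classic ->
    c - d <= \sum_(p <- l) if x \in p.2 then p.1 else 0.
  move=> /set_mem[Bx Ax]; have := le_c x (mem_set Bx).
  by rewrite big_cons /= mem_set // lerBlDl.
have /IHl leD x : x \in (B `\` A)%classic ->
    c <= \sum_(p <- l) if x \in p.2 then p.1 else 0.
  move=> /set_mem[Bx nAx]; have := le_c x (mem_set Bx).
  by rewrite big_cons /= memNset // add0r.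
under eq_bigr do rewrite split_mu mulrDr.
rewrite big_split /=.
by move: leA leD; rewrite mulrBl; lra.
Qed.

Lemma step_integral_ge0 l : (forall x, 0 <= step l x) -> 0 <= step_integral l.
Proof.
move=> l0; have := @step_integral_ge_on l setT 0 (fun x _ => l0 x).
by rewrite mul0r; under eq_bigr do rewrite setTI.
Qed.

Lemma step_cat l1 l2 x : step (l1 ++ l2) x = step l1 x + step l2 x.
Proof. exact: big_cat. Qed.

Lemma step_integral_cat l1 l2 :
  step_integral (l1 ++ l2) = step_integral l1 + step_integral l2.
Proof. exact: big_cat. Qed.

Definition step_opp (l : seq (R * set X)) := [seq (- p.1, p.2) | p <- l].

Lemma step_oppE l x : step (step_opp l) x = - step l x.
Proof.
rewrite /step big_map -sumrN; apply: eq_bigr => p _ /=.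
by case: ifP => //; rewrite oppr0.
Qed.

Lemma step_integral_opp l : step_integral (step_opp l) = - step_integral l.
Proof.
rewrite /step_integral big_map -sumrN; apply: eq_bigr => p _ /=.
by rewrite mulNr.
Qed.

Lemma step_integral_le l1 l2 :
  (forall x, step l1 x <= step l2 x) -> step_integral l1 <= step_integral l2.
Proof.
move=> le12; rewrite -subr_ge0 -step_integral_opp -step_integral_cat.
apply: step_integral_ge0 => x.
by rewrite step_cat step_oppE subr_ge0.
Qed.

Lemma step_cst c x : step [:: (c, setT)] x = c.
Proof. by rewrite /step big_seq1 /= in_setT. Qed.

Lemma step_integral_cst c : step_integral [:: (c, setT)] = c.
Proof. by rewrite /step_integral big_seq1 /= muT mulr1. Qed.

(** Peel off one layer of height [e] at a time, where [f] is at least [e]. *)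
Lemma step_approx_ge0 (e : R) n (f : X -> R) : 0 < e ->
  (forall x, 0 <= f x <= e *+ n) ->
  exists l, forall x, 0 <= step l x <= f x /\ f x <= step l x + e.
Proof.
move=> e0; elim: n f => [|n IHn] f f_le.
  exists [::] => x; rewrite /step big_nil; have := f_le x; rewrite mulr0n.
  by move=> /andP[? ?]; split; [rewrite lexx|]; lra.
have [x|l lP] := IHn (fun x => if e <= f x then f x - e else 0).
  have := f_le x; have : 0 <= e *+ n by rewrite mulrn_wge0 // ltW.
  rewrite mulrSr; move: (e *+ n) => en en0 /andP[? ?]; case: (leP e (f x)) => ?.
    by apply/andP; split; lra.
  by rewrite lexx.
exists ((e, [set y : X | e <= f y]%classic) :: l) => x.
rewrite /step big_cons -/(step l x) /=.
have := lP x; have /andP[? ?] := f_le x; case: (leP e (f x)) => ex.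
  rewrite mem_set // => -[/andP[? ?] ?].
  by split; [apply/andP; split|]; lra.
rewrite memNset; last by rewrite /= leNgt ex.
move=> -[/andP[? ?] ?].
by split; [apply/andP; split|]; lra.
Qed.

Lemma step_approx (e : R) (f : X -> R) : 0 < e -> bounded f ->
  exists l, forall x, f x <= step l x <= f x + e.
Proof.
move=> e0 [M fM].
have fM' x : - M <= f x <= M by rewrite -ler_norml.
have [n Mn] : exists n, 2 * M <= e *+ n.
  have [n Mn] : exists n : nat, 2 * M / e <= n%:R.
    exists (Num.bound `|2 * M / e|).
    exact: le_trans (ler_norm _) (ltW (archi_boundP (normr_ge0 _))).
  by exists n; rewrite -[e *+ n]mulr_natl -ler_pdivrMr.
have [x|l lP] := @step_approx_ge0 e n (fun x => f x + M) e0.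
  by have /andP[? ?] := fM' x; apply/andP; split; lra.
exists (l ++ [:: (e - M, setT)]) => x; rewrite step_cat step_cst.
by have [/andP[? ?] ?] := lP x; apply/andP; split; lra.
Qed.

Definition upper_sums (f : X -> R) : set R :=
  [set step_integral l | l in [set l | forall x, f x <= step l x]].

(** For a bounded function the infimum of the upper sums is additive, because
    step functions approximate it uniformly from above: this makes the
    subadditive [integral] odd. *)
Definition integral (f : X -> R) := inf (upper_sums f).

Lemma has_inf_upper_sums f : bounded f -> has_inf (upper_sums f).
Proof.
move=> [M fM]; have fM' x : - M <= f x <= M by rewrite -ler_norml.
split.
  exists M, [:: (M, setT)]; last exact: step_integral_cst.
  by move=> x; rewrite step_cst; case/andP: (fM' x).
exists (- M) => _ [l lf <-]; rewrite -[X in X <= _]step_integral_cst.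
apply: step_integral_le => x; rewrite step_cst.
by apply: le_trans (lf x); case/andP: (fM' x).
Qed.

Lemma integral_le_step f l : bounded f ->
  (forall x, f x <= step l x) -> integral f <= step_integral l.
Proof.
by move=> bf lf; apply: ge_inf; [exact: (has_inf_upper_sums bf).2|exists l].
Qed.

Lemma integral_ge f c : bounded f ->
  (forall l, (forall x, f x <= step l x) -> c <= step_integral l) ->
  c <= integral f.
Proof.
move=> bf lf; apply: lb_le_inf; first exact: (has_inf_upper_sums bf).1.
by move=> _ [l fl <-]; apply: lf.
Qed.

Lemma integral_subadd f g : bounded f -> bounded g ->
  integral (fun x => f x + g x) <= integral f + integral g.
Proof.
move=> bf bg; rewrite -lerBlDr; apply: integral_ge => // l lf.
rewrite lerBlDr addrC -lerBlDr; apply: integral_ge => // l' lg.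
rewrite lerBlDr -step_integral_cat; apply: integral_le_step.
  exact: boundedD.
by move=> x; rewrite step_cat addrC lerD.
Qed.

Lemma integralN f : bounded f -> integral (fun x => - f x) = - integral f.
Proof.
move=> bf; apply/eqP; rewrite eq_le; apply/andP; split; last first.
  rewrite lerNl; apply: integral_ge => // l lf; rewrite lerNl.
  apply: integral_ge => [|l' lf']; first exact: boundedN.
  rewrite -step_integral_opp; apply: step_integral_le => x.
  by rewrite step_oppE; apply: le_trans (lf' x); rewrite lerN2.
apply/ler_addgt0Pr => e e0; have [l lP] := step_approx e0 bf.
have le1 : integral (fun x => - f x) <=
    step_integral (step_opp l ++ [:: (e, setT)]).
  apply: integral_le_step; first exact: boundedN.
  move=> x; rewrite step_cat step_oppE step_cst.
  by have /andP[? ?] := lP x; lra.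
apply: le_trans le1 _; rewrite step_integral_cat step_integral_opp.
rewrite step_integral_cst lerD2r lerN2; apply: integral_le_step => // x.
by have /andP[] := lP x.
Qed.

Lemma integral_is_mean : is_mean integral.
Proof.
split.
- move=> f g bf bg; apply/eqP; rewrite eq_le integral_subadd //=.
  rewrite -lerBrDr -integralN //.
  apply: le_trans (integral_subadd _ _); [|exact: boundedD|exact: boundedN].
  by under [in X in _ <= X]eq_fun do rewrite addrK.
- move=> f g bf bg fg; apply: integral_ge => // l lg.
  by apply: integral_le_step => // x; apply: le_trans (lg x).
- move=> c; apply/eqP; rewrite eq_le; apply/andP; split.
    rewrite -[X in _ <= X]step_integral_cst; apply: integral_le_step.
      exact: bounded_cst.
    by move=> x; rewrite step_cst.
  apply: integral_ge; first exact: bounded_cst.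
  move=> l lc; rewrite -[X in X <= _]step_integral_cst.
  by apply: step_integral_le => x; rewrite step_cst.
Qed.

Lemma integral_comp (tau sigma : X -> X) f :
    cancel tau sigma -> cancel sigma tau ->
    (forall A, mu [set sigma x | x in A]%classic = mu A) ->
  bounded f -> integral (fun x => f (tau x)) <= integral f.
Proof.
move=> tauK sigmaK mu_sigma bf; apply: integral_ge => // l lf.
have -> : step_integral l =
    step_integral [seq (p.1, [set sigma x | x in p.2]%classic) | p <- l].
  by rewrite /step_integral big_map; apply: eq_bigr => p _; rewrite mu_sigma.
apply: integral_le_step; first exact: bounded_comp.
move=> x; apply: le_trans (lf _) _; rewrite /step big_map le_eqVlt.
apply/orP; left; apply/eqP; apply: eq_bigr => p _ /=.
congr (if _ then _ else _); apply/idP/idP => /set_mem.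
  by move=> px; apply/mem_set; exists (tau x).
by move=> [y py <-]; rewrite sigmaK; apply/mem_set.
Qed.

End Integral.

Lemma amenable_mean (H : groupType) : amenable R H ->
  exists2 m : (H -> R) -> R, is_mean m &
    forall g, invariant_under m (fun x => g * x)%g.
Proof.
move=> [mu [mu01 muT muU muL _]].
exists (integral mu); first exact: integral_is_mean.
have le g f : bounded f ->
    integral mu (fun x => f (g * x)%g) <= integral mu f.
  move=> bf.
  apply: (@integral_comp _ mu mu01 muT muU _ (fun x => g^-1 * x)%g) => //.
  - by move=> x; rewrite mulKg.
  - by move=> x; rewrite mulVKg.
move=> g f bf; apply/eqP; rewrite eq_le le //=.
apply: le_trans (le g^-1%g _ (bounded_comp _ bf)).
by under [in X in _ <= X]eq_fun do rewrite mulVKg.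
Qed.

Definition mean_bind (X Y : Type) (m : (X -> R) -> R) (m' : X -> (Y -> R) -> R)
  (f : Y -> R) : R := m (fun x => m' x f).

Lemma bounded_means X Y (m' : X -> (Y -> R) -> R) f :
  (forall x, is_mean (m' x)) -> bounded f -> bounded (fun x => m' x f).
Proof. by move=> m'P [M fM]; exists M => x; exact: mean_norm (m'P x) fM. Qed.

Lemma mean_bind_is_mean X Y (m : (X -> R) -> R) (m' : X -> (Y -> R) -> R) :
  is_mean m -> (forall x, is_mean (m' x)) -> is_mean (mean_bind m m').
Proof.
move=> mP m'P; have bm' := bounded_means m'P; split.
- move=> f g bf bg; rewrite /mean_bind -(meanD mP); try exact: bm'.
  by congr m; apply/funext => x; rewrite (meanD (m'P _)).
- move=> f g bf bg fg; apply: (mean_le mP); try exact: bm'.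
  by move=> x; exact: (mean_le (m'P x)).
- move=> c; rewrite /mean_bind; under eq_fun do rewrite (mean_cst (m'P _)).
  exact: (mean_cst mP).
Qed.

Definition mean_push (X Y : Type) (h : X -> Y) (m : (X -> R) -> R)
  (f : Y -> R) : R := m (fun x => f (h x)).

Lemma mean_push_is_mean X Y (h : X -> Y) m :
  is_mean m -> is_mean (mean_push h m).
Proof.
move=> mP; split=> [f g bf bg|f g bf bg fg|c].
- by rewrite /mean_push -(meanD mP) //; exact: bounded_comp.
- by apply: (mean_le mP) => //; exact: bounded_comp.
- exact: (mean_cst mP).
Qed.

(** Iterating the means of [H] and [B], [m f] averages [f (iota h * v)] first over
    [v], then over [h].  The outer average absorbs [iota H]; an element of [B]
    moves past [iota h] because [iota H] normalises [B], and is then absorbed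
    by the inner average. *)
Lemma mean_extension (H U : groupType) (iota : H -> U) (B : set U)
    (mH : (H -> R) -> R) (mB : (U -> R) -> R) :
    {morph iota : x y / (x * y)%g} ->
    (forall h b, B b -> B ((iota h)^-1 * b * iota h)%g) ->
    is_mean mH -> (forall h, invariant_under mH (fun x => h * x)%g) ->
    is_mean mB -> (forall b, B b -> invariant_under mB (fun u => b * u)%g) ->
  exists2 m : (U -> R) -> R, is_mean m &
    forall u, B u \/ (exists h, u = iota h) -> invariant_under m (fun v => u * v)%g.
Proof.
move=> iotaM normB mHP mHI mBP mBI.
pose m' h := mean_push (fun v => iota h * v)%g mB.
have m'P h : is_mean (m' h) by exact: mean_push_is_mean.
exists (mean_bind mH m'); first exact: mean_bind_is_mean.
move=> u uP f bf; rewrite /mean_bind; case: uP => [Bu|[g ->]].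
  congr mH; apply/funext => h; rewrite /m' /mean_push.
  rewrite -[RHS](mBI _ (normB h u Bu)); last exact: bounded_comp.
  by congr mB; apply/funext => v; rewrite !mulgA mulgV mul1g.
rewrite -[RHS](mHI g); last exact: bounded_means.
congr mH; apply/funext => h; congr mB; apply/funext => v.
by rewrite iotaM mulgA.
Qed.

(** The values of the means at a bounded function lie in a compact interval, so
    they converge along an ultrafilter finer than [F]. *)
Lemma mean_limit (I X : Type) (F : set_system I) (m : I -> (X -> R) -> R) :
    ProperFilter F -> (forall i, is_mean (m i)) ->
  exists2 mm : (X -> R) -> R, is_mean mm &
    forall f g, bounded f -> bounded g ->
      (\forall i \near F, m i f = m i g) -> mm f = mm g.
Proof.
move=> FF mP; have [G [GU FG]] := ultraFilterLemma FF.
have PG : ProperFilter G := @ultra_proper _ _ GU.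
pose u f i := m i f.
have cvgu f : bounded f -> exists l : R, u f @ G --> l.
  move=> [M fM].
  have GuU : UltraFilter (u f @ G).
    have PF : ProperFilter (u f @ G) by exact: fmap_proper_filter.
    split=> // G' PG' GG'; rewrite predeqE => A; split; last exact: GG'.
    move=> G'A; have [//|GnA] := in_ultra_setVsetC (u f @^-1` A) GU.
    have G'nA : G' (~` A)%classic by exact: GG'.
    by have /filter_ex [? []] : G' (A `&` ~` A)%classic by exact: filterI.
  have := @segment_compact R (- M) M; rewrite compact_ultra => /(_ (u f @ G) _).
  case=> [|l [_ ul]]; last by exists l.
  apply: (@filterS _ G _ setT _ _ filterT) => i _ /=.
  by rewrite in_itv /= -ler_norml; exact: mean_norm.
have limP f : bounded f -> u f @ G --> lim (u f @ G).
  by move=> /cvgu[l ul]; rewrite (cvg_lim _ ul).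
exists (fun f => lim (u f @ G)); last first.
  move=> f g bf bg fg; apply: cvg_lim => //.
  apply: cvg_trans (limP g bg); apply: near_eq_cvg.
  by apply: FG; apply: filterS fg.
split=> [f g bf bg|f g bf bg fg|c].
- apply: cvg_lim => //; rewrite /u.
  under eq_fun do rewrite (meanD (mP _)) //.
  by apply: cvgD; exact: limP.
- rewrite -subr_ge0; apply: (cvgr_to_ge (cvgB (limP g bg) (limP f bf))).
  by apply: nearW => i; rewrite subr_ge0; exact: (mean_le (mP i)).
- rewrite /u; under [X in lim (X @ _)]eq_fun do rewrite (mean_cst (mP _)).
  by apply: cvg_lim => //; exact: cvg_cst.
Qed.

(** The group [G] acts freely on [U] by left translation.  Choosing a point in
    each orbit gives an equivariant map [r] from [U] to [G], through which the
    mean is transported.  Averaging the function [f (x * y^-1)] over [x] and [y]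
    then makes the mean invariant on both sides. *)
Lemma mean_amenable (G U : groupType) (iota : G -> U) (m : (U -> R) -> R) :
    injective iota -> {morph iota : x y / (x * y)%g} ->
    is_mean m -> (forall g, invariant_under m (fun u => iota g * u)%g) ->
  amenable R G.
Proof.
move=> iota_inj iotaM mP mI.
pose orbit u : set U := [set v | exists g, u = (iota g * v)%g].
have orbitM g u : orbit (iota g * u)%g = orbit u.
  have iotaV x y : (iota x^-1 * (iota x * y) = y)%g.
    rewrite mulgA -iotaM mulVg; apply: (mulgI (iota 1%g)).
    by rewrite mulgA -iotaM mulg1.
  apply/seteqP; split=> v [h].
    by move=> /(congr1 (fun w => iota g^-1 * w)%g); rewrite iotaV mulgA -iotaM;
      exists (g^-1 * h)%g.
  by move=> ->; exists (g * h)%g; rewrite iotaM mulgA.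
pose rep u := xget 1%g (orbit u).
have iota1 : iota 1%g = 1%g by apply: (mulgI (iota 1%g)); rewrite -iotaM !mulg1.
have repP u : orbit u (rep u).
  by apply: (@xgetPex _ 1%g (orbit u)); exists u, 1%g; rewrite iota1 mul1g.
pose r u := xget 1%g [set g | u = (iota g * rep u)%g]%classic.
have rP u : u = (iota (r u) * rep u)%g.
  by have [g gP] := repP u; exact: (@xgetPex _ 1%g [set g | _]%classic (ex_intro _ g gP)).
have rM g u : r (iota g * u)%g = (g * r u)%g.
  apply: iota_inj; apply: (mulIg (rep (iota g * u)%g)); rewrite -rP.
  by rewrite /rep orbitM -/(rep u) iotaM -mulgA -rP.
pose mG := mean_push r m.
have mGP : is_mean mG by exact: mean_push_is_mean.
have mGI g : invariant_under mG (fun x => g * x)%g.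
  move=> f bf; rewrite /mG /mean_push -[RHS](mI g); last exact: bounded_comp.
  by congr m; apply/funext => u; rewrite rM.
pose m2 := mean_bind mG (fun x => mean_push (fun y => x * y^-1)%g mG).
have m'P x : is_mean (mean_push (fun y => x * y^-1)%g mG).
  exact: mean_push_is_mean.
have m2P : is_mean m2 by exact: mean_bind_is_mean.
have m2L g : invariant_under m2 (fun x => g * x)%g.
  move=> f bf; rewrite /m2 /mean_bind -[RHS](mGI g).
    congr mG; apply/funext => x; rewrite /mean_push.
    by under eq_fun do rewrite mulgA.
  exact: bounded_means m'P bf.
have m2R g : invariant_under m2 (fun x => x * g)%g.
  move=> f bf; rewrite /m2 /mean_bind; congr mG; apply/funext => x.
  rewrite /mean_push -[RHS](mGI (g^-1)%g); last exact: (bounded_comp (fun y => x * y^-1)%g bf).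
  by congr mG; apply/funext => y; rewrite invgM invgK mulgA.
pose ind (A : set G) x : R := if x \in A then 1 else 0.
have ind01 A x : 0 <= ind A x <= 1 by rewrite /ind; case: ifP; rewrite ?lexx ?ler01.
have bind A : bounded (ind A).
  by exists 1 => x; have /andP[? ?] := ind01 A x; rewrite ger0_norm.
exists (fun A => m2 (ind A)); split.
- move=> A; rewrite -[X in X <= _ <= _](mean_cst m2P 0).
  rewrite -[X in _ <= _ <= X](mean_cst m2P 1); apply/andP.
  split; apply: (mean_le m2P) => //; try exact: bounded_cst.
    by move=> x; case/andP: (ind01 A x).
  by move=> x; case/andP: (ind01 A x).
- rewrite -[RHS](mean_cst m2P 1); congr m2; apply/funext => x.
  by rewrite /ind in_setT.
- move=> A B AB0; rewrite -(meanD m2P) //; congr m2; apply/funext => x.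
  rewrite /ind in_setU; case: (boolP (x \in A)) => [/set_mem Ax|_] /=.
    rewrite memNset ?addr0 // => Bx.
    by have : (A `&` B)%classic x by []; rewrite AB0.
  by rewrite add0r.
- move=> A g; rewrite -(m2L g); last exact: bind.
  congr m2; apply/funext => x; rewrite /ind; congr (if _ then _ else _).
  apply/idP/idP => /set_mem; last by move=> Ax; apply/mem_set; exists x.
  by move=> [y Ay /mulgI <-]; apply/mem_set.
- move=> A g; rewrite -(m2R g); last exact: bind.
  congr m2; apply/funext => x; rewrite /ind; congr (if _ then _ else _).
  apply/idP/idP => /set_mem; last by move=> Ax; apply/mem_set; exists x.
  by move=> [y Ay /mulIg <-]; apply/mem_set.
Qed.

End Means.

(** * Annihilators and independent right ideals *)

Section Annihilators.
Variable A : nzRingType.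
Implicit Types a b c u v w z : A.

Definition left_regular a := forall c, a * c = 0 -> c = 0.

Definition annihilating z := exists2 c, c != 0 & z * c = 0.

Lemma left_regularM a b :
  left_regular a -> left_regular b -> left_regular (a * b).
Proof. by move=> ra rb c; rewrite -mulrA => /ra /rb. Qed.

Lemma not_annihilating a : ~ annihilating a -> left_regular a.
Proof.
by move=> na c ac0; have [//|c0] := eqVneq c 0; case: na; exists c.
Qed.

(** An element [a * u = - (b * v)] of the intersection of the two right ideals is
    killed by [z] and by [w], hence by [z - w]. *)
Lemma annihilators_disjoint z w a b : left_regular (z - w) ->
  z * a = 0 -> w * b = 0 -> forall u v, a * u + b * v = 0 -> a * u = 0.
Proof.
move=> zw za wb u v /eqP; rewrite addr_eq0 => /eqP au; apply: zw.
by rewrite mulrBl mulrA za mul0r au mulrN mulrA wb mul0r oppr0 subr0.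
Qed.

End Annihilators.

Section Independence.
Variables (A : nzRingType) (a b : nat -> A).
Hypothesis comm_ba : forall l j, (l < j)%N -> b l * a j = a j * b l.
Hypothesis comm_bb : forall l j, (l < j)%N -> b l * b j = b j * b l.
Hypothesis disjoint_ab : forall j u v, a j * u + b j * v = 0 -> a j * u = 0.

Definition staircase n := (\prod_(l < n) b l) * a n.

Lemma prod_comm n c : (forall l, (l < n)%N -> b l * c = c * b l) ->
  (\prod_(l < n) b l) * c = c * \prod_(l < n) b l.
Proof.
move=> bc; apply/commr_sym/commr_prod => l _.
exact/commr_sym/bc.
Qed.

Lemma staircase_factor j i : (j < i)%N -> exists w, staircase i = b j * w.
Proof.
move=> ji; suff [w Pw] : exists w, \prod_(l < i) b l = b j * w.
  by exists (w * a i); rewrite /staircase Pw mulrA.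
elim: i ji => // i IHi; rewrite ltnS leq_eqVlt big_ord_recr /=.
case/orP=> [/eqP <-|/IHi[w ->]].
  by exists (\prod_(l < j) b l); apply: prod_comm => l; exact: comm_bb.
by exists (w * b i); rewrite mulrA.
Qed.

(** In a relation between the [staircase i], the term with smallest index [j]
    lies in the right ideal of [a j], and all others in that of [b j]; hence it
    vanishes, and the argument repeats with the remaining terms. *)
Lemma staircase_independent n (u : nat -> A) :
  \sum_(i < n) staircase i * u i = 0 ->
  forall i, (i < n)%N -> staircase i * u i = 0.
Proof.
move=> sum0 i lt_in.
pose T j := \sum_(j <= i < n) staircase i * u i.
have T_step j : (j < n)%N -> T j = 0 -> staircase j * u j = 0 /\ T j.+1 = 0.
  move=> jn; rewrite /T big_ltn // => Tj.
  suff a0 : staircase j * u j = 0 by move: Tj; rewrite a0 add0r.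
  have [w Tw] : exists w, T j.+1 = b j * w.
    rewrite /T big_seq.
    apply: (big_ind (fun s => exists w, s = b j * w)).
    - by exists 0; rewrite mulr0.
    - by move=> _ _ [w ->] [w' ->]; exists (w + w'); rewrite mulrDr.
    - move=> i'; rewrite mem_index_iota => /andP[/staircase_factor[w ->] _].
      by exists (w * u i'); rewrite mulrA.
  move: Tj; rewrite -/(T j.+1) Tw /staircase prod_comm; last first.
    by move=> l; exact: comm_ba.
  by rewrite -mulrA; exact: disjoint_ab.
have T0 j : (j <= n)%N -> T j = 0.
  elim: j => [|j IHj] jn; first by rewrite /T big_mkord.
  by have [] := T_step j jn (IHj (ltnW jn)).
by have [] := T_step i lt_in (T0 i (ltnW lt_in)).
Qed.

End Independence.

Lemma infinite_dimension_of_independent (A : nzRingType) (x : nat -> A) :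
    (forall n, x n != 0) ->
    (forall n (u : nat -> A), \sum_(i < n) x i * u i = 0 ->
      forall i, (i < n)%N -> x i * u i = 0) ->
  infinite_right_uniform_dimension A.
Proof.
move=> x0 x_indep.
exists (fun n (y : A^c^o) => `[< exists u : A, y = x n * u :> A >]); split.
- move=> i; split; first by apply/asboolP; exists 0; rewrite mulr0.
  move=> c _ _ /asboolP[u ->] /asboolP[v ->]; apply/asboolP.
  by exists (u * (c : A) + v); rewrite mulrDr mulrA.
- by move=> i; exists (x i); [apply/asboolP; exists 1; rewrite mulr1|exact: x0].
- move=> n y yN sum0 i lt_in.
  have [u uP] := choice (fun j => asboolP _ (yN j)).
  rewrite uP; apply: (x_indep n u _ i lt_in).
  by rewrite -[RHS]sum0; apply: eq_bigr => j _; rewrite uP.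
Qed.

(** * Group algebras *)

Section GroupAlgebraTheory.
Variable k : fieldType.

Definition mono (U : groupType) (c : k) (x : U) : group_algebra k U :=
  << c *g x >>.

Section OneGroup.
Variable U : groupType.
Implicit Types (a b c : group_algebra k U) (K C : {pred U}) (x y z : U).
Implicit Types r s : k.

Lemma monoM r s (x y : U) : mono r x * mono s y = mono (r * s) (x * y)%g.
Proof. exact: galg_mulUU. Qed.

Lemma galgE a : a = \sum_(x <- msupp a) mono a@_x x.
Proof. exact: monalgE. Qed.

Lemma galgP a b : (forall x, a@_x = b@_x) <-> a = b.
Proof. exact: malgP. Qed.

Lemma coeffD x a b : (a + b)@_x = a@_x + b@_x.
Proof. exact: mcoeffD. Qed.

Lemma coeffN x a : (- a)@_x = - a@_x.
Proof. exact: mcoeffN. Qed.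

Lemma coeff0 x : (0 : group_algebra k U)@_x = 0.
Proof. exact: mcoeff0. Qed.

Lemma coeff_sum I (s : seq I) (F : I -> group_algebra k U) x :
  (\sum_(i <- s) F i)@_x = \sum_(i <- s) (F i)@_x.
Proof. exact: (big_morph _ (coeffD x) (coeff0 x)). Qed.

Lemma coeff_mono r x y : (mono r x)@_y = r *+ (x == y).
Proof. exact: mcoeffU. Qed.

Lemma coeff_monoMl r x a y : (mono r x * a)@_y = r * a@_(x^-1 * y)%g.
Proof.
rewrite [in LHS](galgE a) mulr_sumr coeff_sum [in RHS](galgE a) coeff_sum.
rewrite mulr_sumr; apply: eq_bigr => z _.
by rewrite monoM !coeff_mono mulrnAr (can2_eq (mulKg x) (mulVKg x)).
Qed.

Lemma coeff_monoMr r x a y : (a * mono r x)@_y = a@_(y * x^-1)%g * r.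
Proof.
rewrite [in LHS](galgE a) mulr_suml coeff_sum [in RHS](galgE a) coeff_sum.
rewrite mulr_suml; apply: eq_bigr => z _.
by rewrite monoM !coeff_mono mulrnAl (can2_eq (mulgK x) (mulgVK x)).
Qed.

Lemma mono0 x : mono 0 x = 0.
Proof. exact: monalgU0. Qed.

Lemma galg_neq0P a : reflect (exists x, a@_x != 0) (a != 0).
Proof.
apply: (iffP idP) => [|[x ax]]; last first.
  by apply: contraNneq ax => ->; rewrite coeff0.
apply: contraPP => /forallNP a0; apply/negP; rewrite negbK; apply/eqP/galgP => x.
by rewrite coeff0; apply/eqP/negPn/negP/(a0 x).
Qed.

Definition supported K a := {subset msupp a <= K}.

Lemma supportedP K a : supported K a <-> forall x, x \notin K -> a@_x = 0.
Proof.
split=> [aK x|aK x].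
  by apply: contraNeq; rewrite mcoeff_neq0 => /aK.
by rewrite -mcoeff_neq0; apply: contraNT => /aK ->.
Qed.

Lemma supported_sum K (I : eqType) (e : seq I) (F : I -> group_algebra k U) :
  (forall i, i \in e -> supported K (F i)) ->
  supported K (\sum_(i <- e) F i).
Proof.
move=> FK; apply/supportedP => x xK; rewrite coeff_sum big_seq big1 // => i.
by move=> /FK /supportedP ->.
Qed.

Lemma supportedB K a b : supported K a -> supported K b -> supported K (a - b).
Proof.
move=> /supportedP aK /supportedP bK; apply/supportedP => x xK.
by rewrite coeffD coeffN aK ?bK ?subr0.
Qed.

Lemma supported_mono K r x : x \in K -> supported K (mono r x).
Proof.
move=> xK; apply/supportedP => y; rewrite coeff_mono.
by case: eqP => [<-|]; rewrite ?xK.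
Qed.

Lemma supported1 K : 1%g \in K -> supported K 1.
Proof. exact: supported_mono. Qed.

Lemma supportedM K a b :
  group_closed K -> supported K a -> supported K b -> supported K (a * b).
Proof.
move=> K_closed aK bK; rewrite (galgE a) (galgE b) mulr_suml.
apply: supported_sum => y /aK yK; rewrite mulr_sumr.
apply: supported_sum => z /bK zK; rewrite monoM.
by apply: supported_mono; exact: group_closedM.
Qed.

(** The projection of the group algebra onto that of the subgroup [K]; it is a
    morphism of left modules over the latter, see [restrictM]. *)
Definition restrict K a : group_algebra k U :=
  [malg x in msupp a => if x \in K then a@_x else 0].

Lemma coeff_restrict K a x :
  (restrict K a)@_x = if x \in K then a@_x else 0.
Proof.
rewrite mcoeffE; case: ifP => // /negbT; rewrite -mcoeff_eq0 => /eqP ->.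
by rewrite if_same.
Qed.

Lemma restrict_supported K a : supported K (restrict K a).
Proof. by apply/supportedP => x /negPf xK; rewrite coeff_restrict xK. Qed.

Lemma restrictM K a b : group_closed K -> supported K a ->
  restrict K (a * b) = a * restrict K b.
Proof.
move=> K_closed aK; apply/galgP => y; rewrite coeff_restrict.
rewrite [in LHS](galgE a) [in RHS](galgE a) !mulr_suml !coeff_sum.
have [yK|yK] := boolP (y \in K).
  rewrite big_seq [RHS]big_seq; apply: eq_bigr => x /aK xK.
  rewrite !coeff_monoMl coeff_restrict.
  by rewrite (group_closedM K_closed) // (group_closedV K_closed).
rewrite big_seq big1 // => x /aK xK; rewrite coeff_monoMl coeff_restrict.
case: ifP => [xyK|]; last by rewrite mulr0.
by rewrite -(mulVKg x y) (group_closedM K_closed) in yK.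
Qed.

(** The group algebra is a free left module over that of a subgroup, so right
    annihilators of elements of the latter can be found inside it: translate
    [c] until its support meets [K], then project. *)
Lemma annihilator_restrict K a c : group_closed K -> supported K a ->
  c != 0 -> a * c = 0 ->
  exists c', [/\ supported K c', c' != 0 & a * c' = 0].
Proof.
move=> K_closed aK /galg_neq0P[x cx] ac0.
exists (restrict K (c * mono 1 x^-1)); split.
- exact: restrict_supported.
- apply/galg_neq0P; exists 1%g.
  by rewrite coeff_restrict K_closed.1 coeff_monoMr invgK mul1g mulr1.
- rewrite -restrictM // mulrA ac0 mul0r; apply/galgP => y.
  by rewrite coeff_restrict coeff0 if_same.
Qed.

(** Since [K] and [C] meet trivially, translating [c] by an element of its support
    makes its projection to [K] a nonzero scalar. *)
Lemma mul_neq0_disjoint K C b c : group_closed K -> group_closed C ->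
  (forall x, x \in K -> x \in C -> x = 1%g) ->
  supported K b -> supported C c -> b != 0 -> c != 0 -> b * c != 0.
Proof.
move=> K_closed C_closed KC1 bK cC b0 /galg_neq0P[x cx].
have xC : x \in C by apply: cC; rewrite -mcoeff_neq0.
have res_c : restrict K (c * mono 1 x^-1) = mono c@_x 1%g.
  apply/galgP => y; rewrite coeff_restrict coeff_monoMr invgK coeff_mono mulr1.
  case: eqP => [<-|y1]; first by rewrite K_closed.1 mul1g.
  case: ifP => // yK; move/supportedP: cC => -> //.
  apply/negP => yxC; apply: y1; rewrite (KC1 y) //.
  rewrite -(mulgK x y) (group_closedM C_closed) //.
  exact: (group_closedV C_closed).
apply: contraNneq b0 => bc0; apply/eqP/galgP => y.
have := restrictM (c * mono 1 x^-1) K_closed bK.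
rewrite mulrA bc0 mul0r res_c => /galgP/(_ y).
rewrite coeff_restrict !coeff0 if_same coeff_monoMr invg1 mulg1 => /esym/eqP.
by rewrite mulf_eq0 (negPf cx) orbF => /eqP.
Qed.

Lemma supported_comm K C b c :
  (forall x y, x \in K -> y \in C -> (x * y = y * x)%g) ->
  supported K b -> supported C c -> b * c = c * b.
Proof.
move=> KC bK cC; suff : GRing.comm b c by [].
rewrite (galgE b) (galgE c) big_seq [X in GRing.comm _ X]big_seq.
apply: commr_sum => y /cC yC; apply/commr_sym/commr_sum => x /bK xK.
by rewrite /GRing.comm !monoM mulrC (KC x y).
Qed.

Lemma left_regular_mono r x : r != 0 -> left_regular (mono r x).
Proof.
move=> r0 c /(congr1 (fun d => mono r^-1 x^-1 * d)).
by rewrite mulrA monoM mulVf // mulVg mul1r mulr0.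
Qed.

Lemma torsion_free_expg_inj x :
  torsion_free U -> x != 1%g -> injective (fun n : nat => x ^+ n)%g.
Proof.
move=> tfU x1 m n; wlog le_mn : m n / (m <= n)%N => [hw|] /= eq_mn.
  by case/orP: (leq_total m n) => /hw; [|move/(_ (esym eq_mn))->]; exact.
apply/eqP; rewrite eqn_leq le_mn leqNgt /=; apply: contra x1 => lt_mn.
apply/eqP/(tfU x (n - m)%N); first by rewrite subn_gt0.
by apply: (mulgI (x ^+ m)%g); rewrite -expgnDr subnKC // mulg1 eq_mn.
Qed.

(** The support of an element killed by [x - y] is stable under translation by
    [y^-1 * x], which has infinite order; being finite, it is empty. *)
Lemma left_regular_sub x y :
  torsion_free U -> x != y -> left_regular (mono 1 x - mono 1 y).
Proof.
move=> tfU xy c; rewrite mulrBl => /subr0_eq eqc.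
apply/eqP; apply: contraT => /galg_neq0P[u cu].
pose v := (y^-1 * x)%g.
have v1 : v != 1%g.
  by apply: contra xy => /eqP v1; rewrite -(mulVKg y x) -/v v1 mulg1.
have step w : c@_(v * w)%g = c@_w.
  have /galgP/(_ (x * w)%g) := eqc.
  by rewrite !coeff_monoMl !mul1r mulKg mulgA => <-.
have c_exp n : c@_((v ^+ n) * u)%g = c@_u.
  elim: n => [|n IHn]; first by rewrite mul1g.
  by rewrite expgS -mulgA step.
pose f (n : 'I_(#|` msupp c|.+1)) := ((v ^+ n) * u)%g.
have f_inj : injective f.
  move=> m n /mulIg /(torsion_free_expg_inj tfU v1); exact: val_inj.
have /fsubset_leq_card : ([fset f n | n in 'I_(#|` msupp c|.+1)] `<=` msupp c)%fset.
  apply/fsubsetP => _ /imfsetP[n _ ->].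
  by rewrite -mcoeff_neq0 c_exp.
by rewrite card_imfset //= -cardE card_ord ltnn.
Qed.

End OneGroup.

Section Push.
Variables (U V : groupType) (f : U -> V).

Definition push (a : group_algebra k U) : group_algebra k V :=
  \sum_(x <- msupp a) mono a@_x (f x).

Lemma pushE (d : {fset U}) a : (msupp a `<=` d)%fset ->
  push a = \sum_(x <- d) mono a@_x (f x).
Proof.
move=> le_d; apply: big_fset_incl => // x _ /mcoeff_outdom ->.
exact: mono0.
Qed.

Lemma pushD : {morph push : a b / a + b}.
Proof.
move=> a b; rewrite (pushE (msuppD_le a b)).
rewrite (pushE (fsubsetUl _ (msupp b))) (pushE (fsubsetUr (msupp a) _)).
by rewrite -big_split; apply: eq_bigr => x _; rewrite -[RHS]monalgUD -coeffD.
Qed.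

Lemma push0 : push 0 = 0.
Proof. by rewrite /push msupp0 big_seq_fset0. Qed.

Lemma push_sum I (s : seq I) (F : I -> group_algebra k U) :
  push (\sum_(i <- s) F i) = \sum_(i <- s) push (F i).
Proof. exact: (big_morph _ pushD push0). Qed.

Lemma push_mono r x : push (mono r x) = mono r (f x).
Proof.
by rewrite (pushE msuppU_le) big_seq_fset1 coeff_mono eqxx.
Qed.

Lemma pushM : {morph f : x y / (x * y)%g} -> {morph push : a b / a * b}.
Proof.
move=> fM a b; rewrite [in LHS](galgE a) [in LHS](galgE b) mulr_suml push_sum.
rewrite [in RHS]/push mulr_suml; apply: eq_bigr => x _.
rewrite !mulr_sumr push_sum; apply: eq_bigr => y _.
by rewrite !monoM push_mono fM.
Qed.

Lemma coeff_push a x : injective f -> (push a)@_(f x) = a@_x.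
Proof.
move=> f_inj; rewrite [in RHS](galgE a) !coeff_sum; apply: eq_bigr => y _.
by rewrite !coeff_mono (inj_eq f_inj).
Qed.

Lemma push_inj : injective f -> injective push.
Proof.
by move=> f_inj a b ab; apply/galgP => x; rewrite -!(coeff_push _ x f_inj) ab.
Qed.

Lemma push_surj (K : {pred V}) b : supported K b ->
  (forall y, y \in K -> exists x, f x = y) -> exists a, push a = b.
Proof.
move=> bK fK.
have [y|h hK] := @choice _ _ (fun y x => y \in K -> f x = y).
  by case: (boolP (y \in K)) => [/fK[x fx]|_]; [exists x|exists 1%g].
exists (\sum_(y <- msupp b) mono b@_y (h y)).
rewrite push_sum [RHS]galgE big_seq [RHS]big_seq.
by apply: eq_bigr => y /bK yK; rewrite push_mono hK.
Qed.

End Push.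

End GroupAlgebraTheory.

(** * Subgroups *)

Section Subgroup.
Variables (U : groupType) (K : pred U).
Hypothesis K_closed : group_closed K.

(** The closure proof is an argument of the type because the group structure
    depends on it. *)
Definition subgroup_of of group_closed K := {x : U | K x}.
Local Notation G := (subgroup_of K_closed).

HB.instance Definition _ := SubChoice.on G.
HB.instance Definition _ := SubChoice_isSubGroup.Build U K G K_closed.

Definition subgroup : groupType := G.
Definition subgroup_val (x : subgroup) : U := val (x : G).

Lemma subgroup_val_inj : injective subgroup_val.
Proof. exact: val_inj. Qed.

Lemma subgroup_valM : {morph subgroup_val : x y / (x * y)%g}.
Proof. exact: valM. Qed.

Lemma subgroup_valP x : subgroup_val x \in K.
Proof. exact: valP (x : G). Qed.

Lemma subgroup_val_surj y : y \in K -> exists x, subgroup_val x = y.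
Proof. by move=> Ky; exists (Sub y Ky : G); exact: SubK. Qed.

End Subgroup.

Lemma morph_one (G U : groupType) (f : G -> U) :
  {morph f : x y / (x * y)%g} -> f 1%g = 1%g.
Proof. by move=> fM; apply: (mulgI (f 1%g)); rewrite -fM !mulg1. Qed.

Lemma morph_inv (G U : groupType) (f : G -> U) :
  {morph f : x y / (x * y)%g} -> {morph f : x / (x^-1)%g}.
Proof.
move=> fM x; apply: (mulgI (f x)).
by rewrite -fM !mulgV (morph_one fM).
Qed.

Lemma torsion_free_morph (G U : groupType) (f : G -> U) :
  {morph f : x y / (x * y)%g} -> injective f ->
  torsion_free U -> torsion_free G.
Proof.
move=> fM f_inj tfU x n n0 xn; apply: f_inj; rewrite (morph_one fM).
apply: (tfU _ n n0); rewrite -(morph_one fM) -xn.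
elim: (n) => [|m IHm]; first by rewrite (morph_one fM).
by rewrite !expgS fM IHm.
Qed.

Section Generated.
Variable U : groupType.

Definition generated (s : seq U) : pred U := fun x =>
  `[< forall K : {pred U}, group_closed K -> {subset s <= K} -> x \in K >].

Lemma generated_closed s : group_closed (generated s).
Proof.
split; first by apply/asboolP => K [].
move=> x y /asboolP xK /asboolP yK; apply/asboolP => K K_closed sK.
by apply: K_closed.2; [exact: xK|exact: yK].
Qed.

Lemma mem_generated s : {subset s <= generated s}.
Proof. by move=> x xs; apply/asboolP => K _; exact. Qed.

Definition generated_group s := subgroup (generated_closed s).

Lemma generated_group_fg s : finitely_generated (generated_group s).
Proof.
pose v := @subgroup_val U _ (generated_closed s).
have vM : {morph v : x y / (x * y)%g} by exact: subgroup_valM.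
have [s' s'P] : exists s' : seq (generated_group s), map v s' = s.
  suff lift t : {subset t <= generated s} -> exists s', map v s' = t.
    exact: lift (@mem_generated s).
  elim: t => [|x t IHt] ts; first by exists [::].
  have [t' <-] := IHt (fun y yt => ts y (@mem_behead _ (x :: t) y yt)).
  have [x' <-] := subgroup_val_surj (generated_closed s) (ts x (mem_head _ _)).
  by exists (x' :: t').
exists s' => S S_closed s'S x.
pose K : {pred U} := fun y => `[< exists2 z, z \in S & v z = y >].
have K_closed : group_closed K.
  split.
    by apply/asboolP; exists 1%g; [exact: S_closed.1|exact: morph_one].
  move=> _ _ /asboolP[y yS <-] /asboolP[z zS <-]; apply/asboolP.
  exists (y * z^-1)%g; first exact: S_closed.2.
  by rewrite vM (morph_inv vM).
have sK : {subset s <= K}.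
  by move=> y; rewrite -s'P => /mapP[z zs' ->]; apply/asboolP; exists z => //; exact: s'S.
have /asboolP/(_ K K_closed sK)/asboolP[z zS] := subgroup_valP x.
by move=> /subgroup_val_inj <-.
Qed.

End Generated.

(** * Unrestricted wreath products *)

Definition wreath (H : groupType) : Type := ((H -> H) * H)%type.

HB.instance Definition _ (H : groupType) := Choice.on (wreath H).

Section Wreath.
Variable H : groupType.
Implicit Types u v w : wreath H.

Definition wreath_one : wreath H := (fun=> 1%g, 1%g).

(** The pair [(f, h)] is [f] times the translation [h], where [h] acts on functions
    by [(h f) p = f (h^-1 p)]. *)
Definition wreath_mul u v : wreath H :=
  (fun p => u.1 p * v.1 (u.2^-1 * p), u.2 * v.2)%g.
Definition wreath_inv u : wreath H :=
  (fun p => (u.1 (u.2 * p))^-1, u.2^-1)%g.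

Lemma wreathP u v : u.1 =1 v.1 -> u.2 = v.2 -> u = v.
Proof. by case: u v => [f x] [g y] /= /funext -> ->. Qed.

Lemma wreath_mulA : associative wreath_mul.
Proof.
move=> u v w; apply: wreathP => [p|] /=; last by rewrite mulgA.
by rewrite invgM !mulgA.
Qed.

Lemma wreath_mul1 : left_id wreath_one wreath_mul.
Proof.
by move=> u; apply: wreathP => [p|] /=; rewrite ?invg1 !mul1g.
Qed.

Lemma wreath_mulr1 : right_id wreath_one wreath_mul.
Proof. by move=> u; apply: wreathP => [p|] /=; rewrite mulg1. Qed.

Lemma wreath_mulV : left_inverse wreath_one wreath_inv wreath_mul.
Proof.
move=> u; apply: wreathP => [p|] /=; last by rewrite mulVg.
by rewrite invgK mulVg.
Qed.

Lemma wreath_mulrV : right_inverse wreath_one wreath_inv wreath_mul.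
Proof.
move=> u; apply: wreathP => [p|] /=; last by rewrite mulgV.
by rewrite mulVKg mulgV.
Qed.

HB.instance Definition _ := isGroup.Build (wreath H)
  wreath_mulA wreath_mul1 wreath_mulr1 wreath_mulV wreath_mulrV.

Lemma wreath_mulE u v :
  (u * v)%g = (fun p => u.1 p * v.1 (u.2^-1 * p), u.2 * v.2)%g.
Proof. by []. Qed.

Lemma torsion_free_wreath : torsion_free H -> torsion_free (wreath H).
Proof.
move=> tfH u n n0 un1.
have exp2 m : (u ^+ m)%g.2 = (u.2 ^+ m)%g.
  by elim: m => // m IHm; rewrite !expgS wreath_mulE /= IHm.
have u2 : u.2 = 1%g by apply: (tfH _ n n0); rewrite -exp2 un1.
have exp1 m p : (u ^+ m)%g.1 p = (u.1 p ^+ m)%g.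
  elim: m => // m IHm; rewrite !expgS wreath_mulE /= u2 invg1 mul1g.
  by rewrite IHm.
apply: wreathP => //= p.
by apply: (tfH _ n n0); rewrite -exp1 un1.
Qed.

Definition diag (T : seq H) (g : H) : wreath H :=
  (fun p => if p \in T then g else 1%g, 1%g).

Definition top (h : H) : wreath H := (fun=> 1%g, h).

Lemma diagM T : {morph diag T : x y / (x * y)%g}.
Proof.
move=> x y; apply: wreathP => [p|] /=; last by rewrite mulg1.
by rewrite invg1 mul1g; case: ifP => // _; rewrite mulg1.
Qed.

Lemma diag_inj T : T != [::] -> injective (diag T).
Proof.
case: T => // e T _ x y [/(congr1 (fun f => f e))] /=.
by rewrite mem_head.
Qed.

Lemma diag_cons e T g : e \notin T -> (diag [:: e] g * diag T g)%g = diag (e :: T) g.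
Proof.
move=> eT; apply: wreathP => [p|] /=; last by rewrite mulg1.
rewrite invg1 mul1g !inE; case: eqP => [->|_]; last by rewrite mul1g.
by rewrite (negPf eT) mulg1.
Qed.

Lemma topM : {morph top : x y / (x * y)%g}.
Proof. by move=> x y; apply: wreathP => [p|] //=; rewrite mulg1. Qed.

Lemma top_conj h e g :
  ((top h)^-1 * diag [:: e] g * top h)%g = diag [:: h^-1 * e]%g g.
Proof.
apply: wreathP => [p|] /=; last by rewrite mulg1 mulVg.
rewrite !invg1 mul1g mulg1 invgK !inE.
by rewrite (can2_eq (mulKg h) (mulVKg h)).
Qed.

Definition base_on (E : {pred H}) : {pred wreath H} :=
  fun u => `[< u.2 = 1%g /\ forall p, p \notin E -> u.1 p = 1%g >].

Lemma base_onP E u :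
  reflect (u.2 = 1%g /\ forall p, p \notin E -> u.1 p = 1%g) (u \in base_on E).
Proof. exact: asboolP. Qed.

Lemma base_on_closed E : group_closed (base_on E).
Proof.
split; first exact/base_onP.
move=> u v /base_onP[u2 u1] /base_onP[v2 v1]; apply/base_onP.
split; first by rewrite /= u2 v2 invg1 mulg1.
by move=> p pE; rewrite /= u2 v2 !invg1 !mul1g u1 // v1 // invg1 mulg1.
Qed.

Lemma base_onS (E F : {pred H}) :
  {subset E <= F} -> {subset base_on E <= base_on F}.
Proof.
move=> EF u /base_onP[u2 u1]; apply/base_onP; split=> // p pF.
by apply: u1; apply: contra pF; exact: EF.
Qed.

Lemma diag_base (E : {pred H}) T g : {subset T <= E} -> diag T g \in base_on E.
Proof.
move=> TE; apply/base_onP; split=> // p pE /=.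
by case: ifP => // /TE; rewrite (negPf pE).
Qed.

Lemma base_on_comm (E F : {pred H}) u v : {in E, forall p, p \notin F} ->
  u \in base_on E -> v \in base_on F -> (u * v = v * u)%g.
Proof.
move=> EF /base_onP[u2 u1] /base_onP[v2 v1].
apply: wreathP => [p|] /=; last by rewrite u2 v2.
rewrite u2 v2 invg1 !mul1g.
have [/EF pF|pE] := boolP (p \in E); first by rewrite v1 // mulg1 mul1g.
by rewrite u1 // mulg1 mul1g.
Qed.

Lemma base_on_disjoint (E F : {pred H}) u : {in E, forall p, p \notin F} ->
  u \in base_on E -> u \in base_on F -> u = 1%g.
Proof.
move=> EF /base_onP[u2 u1] /base_onP[_ v1]; apply: wreathP => //= p.
by have [/EF|] := boolP (p \in E); [exact: v1|exact: u1].
Qed.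

End Wreath.

(** * Amenability of subgroups of the wreath product *)

Section WreathAmenable.
Variables (R : realType) (H : groupType).
Local Notation U := (wreath H).

Definition copies (E : seq H) : set U :=
  fun u => exists2 e : H, e \in E & exists g : H, u = diag [:: e] g.

Lemma diag_conj (e h e' g : H) : exists g',
  ((diag [:: e] h)^-1 * diag [:: e'] g * diag [:: e] h)%g = diag [:: e'] g'.
Proof.
pose h' := if e' == e then h else 1%g.
exists (h'^-1 * g * h')%g; apply: wreathP => [p|] /=; last by rewrite !mulg1 invg1.
rewrite !(invg1, mul1g, mulg1) !inE.
have [->|_] := eqVneq p e'; first by rewrite /h'; case: ifP; rewrite ?invg1.
by rewrite mulg1 mulVg.
Qed.

(** Positions are added one at a time.  For the empty list any mean will do, for
    instance the evaluation at [1]. *)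
Lemma copies_mean (m0 : (H -> R) -> R) E :
    is_mean m0 -> (forall g, invariant_under m0 (fun x => g * x)%g) ->
  exists2 m : (U -> R) -> R, is_mean m &
    forall u, copies E u -> invariant_under m (fun v => u * v)%g.
Proof.
move=> m0P m0I; elim: E => [|e E [m mP mI]].
  exists (fun f => f 1%g); last by move=> u [].
  by split=> // f g _ _; exact.
have [||m' m'P m'I] := @mean_extension R H U (diag [:: e]) (copies E) m0 m _ _ m0P m0I mP mI.
- exact: diagM.
- move=> h _ [e' e'E [g ->]]; exists e' => //; exact: diag_conj.
exists m' => // u [e' + [g ->]]; rewrite inE => /predU1P[->|e'E].
  by apply: m'I; right; exists g.
by apply: m'I; left; exists e' => //; exists g.
Qed.

Lemma wreath_mean : amenable R H ->
  exists2 m : (U -> R) -> R, is_mean m &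
    (forall e g, invariant_under m (fun v => diag [:: e] g * v)%g) /\
    (forall h, invariant_under m (fun v => top h * v)%g).
Proof.
move=> /amenable_mean[m0 m0P m0I].
have [E|m mP] := @choice (seq H) ((U -> R) -> R) (fun E m => is_mean m /\
    forall u, copies E u -> invariant_under m (fun v => u * v)%g).
  by have [m mP mI] := copies_mean E m0P m0I; exists m.
(* the filter of sets containing all sufficiently large lists of positions *)
pose F : set_system (seq H) :=
  [set A | exists E0 : seq H, forall E, {subset E0 <= E} -> A E].
have FF : ProperFilter F.
  split.
    by move=> [E /(_ E)]; apply.
  split.
  - by exists [::].
  - move=> A B [E EA] [E' E'B]; exists (E ++ E') => D DE; split.
      by apply: EA => x xE; apply: DE; rewrite mem_cat xE.
    by apply: E'B => x xE; apply: DE; rewrite mem_cat xE orbT.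
  - by move=> A B AB [E EA]; exists E => D /EA /AB.
have [m1 m1P m1I] := mean_limit FF (fun E => (mP E).1).
have [|||m' m'P m'I] := @mean_extension R H U (@top H)
  [set u | exists (e : H) g, u = diag [:: e] g] m0 m1 _ _ m0P m0I m1P.
- exact: topM.
- by move=> h _ [e [g ->]]; exists (h^-1 * e)%g, g; exact: top_conj.
- move=> _ [e [g ->]] f bf; apply: m1I => //; first exact: bounded_comp.
  exists [:: e] => E eE; apply: (mP E).2 => //.
  by exists e; [apply: eE; rewrite inE|exists g].
exists m' => //; split=> [e g|h]; apply: m'I.
  by left; exists e, g.
by right; exists h.
Qed.

Lemma invariant_closed (V : groupType) (m : (V -> R) -> R) :
  group_closed (fun u : V => `[< invariant_under m (fun v => u * v)%g >]).
Proof.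
split.
  by apply/asboolP => f bf; congr m; apply/funext => v; rewrite mul1g.
move=> x y /asboolP xI /asboolP yI; apply/asboolP => f bf.
rewrite -(yI (fun v => f (x * y^-1 * v)%g) (bounded_comp _ bf)) -[RHS](xI f bf).
by congr m; apply/funext => v; rewrite !mulgA mulgVK.
Qed.

Lemma wreath_subgroup_amenable (s : seq U) : amenable R H ->
  {in s, forall u, (exists e g, u = diag [:: e] g) \/ (exists h, u = top h)} ->
  amenable R (generated_group s).
Proof.
move=> /wreath_mean[m mP [mD mT]] sP.
apply: (@mean_amenable R (generated_group s) U (@subgroup_val _ _ _) m).
- exact: subgroup_val_inj.
- exact: subgroup_valM.
- exact: mP.
- move=> g; have /asboolP/(_ _ (invariant_closed m)) := subgroup_valP g.
  move=> /(_ _)/asboolP; apply => u /sP[[e [h ->]]|[h ->]]; apply/asboolP.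
    exact: mD.
  exact: mT.
Qed.

End WreathAmenable.

(** * Two disjoint right ideals from a zero divisor *)

Section Blocks.
Variables (k : fieldType) (H : groupType) (alpha beta : group_algebra k H).
Hypothesis tfH : torsion_free H.
Hypothesis alpha_neq0 : alpha != 0.
Hypothesis beta_neq0 : beta != 0.
Hypothesis alpha_beta : alpha * beta = 0.
Local Notation U := (wreath H).
Local Notation kU := (group_algebra k U).

Definition separator (r : seq (H * H)) (g : H) : kU :=
  \prod_(q <- r) (mono 1 (diag [:: q.1] g) - mono 1 (diag [:: q.1] q.2)).

(** The element that carries the argument: for empty [r] it is the copy of
    [alpha] on [T], which has a nonzero right annihilator, whereas [r] can be
    chosen so as to keep a single term of [alpha]. *)
Definition mixed (T : seq H) (r : seq (H * H)) : kU :=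
  \sum_(g <- msupp alpha) mono alpha@_g (diag T g) * separator r g.

Lemma mixed_nil T : mixed T [::] = push (diag T) alpha.
Proof.
by apply: eq_bigr => g _; rewrite /separator big_nil mulr1.
Qed.

(** Expand the first factor of the separator: its part [diag [:: e] g] merges
    with [diag T g], and its part [diag [:: e] h] does not depend on [g] and
    moves to the front, past the commuting copy on [T]. *)
Lemma mixed_cons T e h r : e \notin T ->
  mixed T ((e, h) :: r) = mixed (e :: T) r - mono 1 (diag [:: e] h) * mixed T r.
Proof.
move=> eT; rewrite /mixed mulr_sumr -sumrB; apply: eq_bigr => g _.
rewrite /separator big_cons -/(separator r g) /= !mulrA -mulrBl; congr (_ * _).
have comm x : (diag T g * diag [:: e] x = diag [:: e] x * diag T g)%g.
  apply: (@base_on_comm _ [pred p | p \in T] [pred p | p == e]).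
  - by move=> p /= pT; apply: contraNneq eT => <-.
  - exact: diag_base.
  - by apply: diag_base => p; rewrite inE.
by rewrite mulrBr !monoM !comm mulr1 mul1r diag_cons.
Qed.

Lemma separator_eq0 r g : g \in map snd r -> separator r g = 0.
Proof.
rewrite /separator; elim: r => //= [[e h] r] IHr; rewrite inE big_cons /=.
by case/predU1P=> [->|/IHr ->]; [rewrite subrr mul0r|rewrite mulr0].
Qed.

Lemma separator_regular r g : g \notin map snd r -> left_regular (separator r g).
Proof.
rewrite /separator; elim: r => [_|[e h] r IHr].
  by rewrite big_nil => c; rewrite mul1r.
rewrite inE big_cons negb_or /= => /andP[gh /IHr]; apply: left_regularM.
apply: left_regular_sub; first exact: torsion_free_wreath.
by apply: contra gh => /eqP /diag_inj ->.
Qed.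

(** The separators of [gs] vanish on all the support of [alpha] but [g0]. *)
Lemma mixed_regular e g0 gs es : msupp alpha = g0 :: gs :> seq H ->
  size es = size gs -> left_regular (mixed [:: e] (zip es gs)).
Proof.
move=> supp_alpha sz; have /andP[g0gs _] : uniq (g0 :: gs).
  by rewrite -supp_alpha fset_uniq.
have snd_zip : map snd (zip es gs) = gs by rewrite -/unzip2 unzip2_zip ?sz.
rewrite /mixed supp_alpha big_cons big_seq big1 ?addr0; last first.
  by move=> g ggs; rewrite separator_eq0 ?mulr0 // snd_zip.
apply: left_regularM; last by apply: separator_regular; rewrite snd_zip.
apply: left_regular_mono.
by rewrite mcoeff_neq0 -[_ \in _]/(_ \in (msupp alpha : seq H)) supp_alpha mem_head.
Qed.

Lemma annihilating_diag T : T != [::] -> annihilating (push (diag T) alpha).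
Proof.
move=> T0; exists (push (diag T) beta).
  apply: contra beta_neq0 => /eqP push0; apply/eqP.
  by apply: (push_inj (diag_inj T0)); rewrite push0 /push msupp0 big_seq_fset0.
rewrite -(pushM (diagM T)) alpha_beta.
by rewrite /push msupp0 big_seq_fset0.
Qed.

Variables (K : {pred U}) (E : seq H).
Hypothesis K_closed : group_closed K.
Hypothesis diagK : forall e g, e \in E -> g \in msupp alpha -> diag [:: e] g \in K.

Lemma diag_mem T g : uniq T -> {subset T <= E} -> g \in msupp alpha ->
  diag T g \in K.
Proof.
move=> + + galpha; elim: T => [_ _|e T IHT /= /andP[eT uT] TE].
  have -> : diag [::] g = 1%g by exact: wreathP.
  exact: K_closed.1.
rewrite -diag_cons //; apply: (group_closedM K_closed).
  by apply: diagK => //; apply: TE; rewrite mem_head.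
by apply: IHT => // p pT; apply: TE; rewrite inE pT orbT.
Qed.

Lemma mixed_supported T r : uniq T -> {subset T <= E} ->
  {subset map fst r <= E} -> {subset map snd r <= msupp alpha} ->
  supported K (mixed T r).
Proof.
move=> uT TE rE ra; apply: supported_sum => g ga; apply: supportedM => //.
  by apply: supported_mono; exact: diag_mem.
rewrite /separator; elim: r rE ra => [|[e h] r IHr] rE ra.
  by rewrite big_nil; apply: supported1; exact: K_closed.1.
rewrite big_cons; apply: supportedM => //.
  apply: supportedB; apply: supported_mono; apply: diagK => //.
  - by apply: rE; rewrite mem_head.
  - by apply: rE; rewrite mem_head.
  - by apply: ra; rewrite mem_head.
apply: IHr => p pr; first by apply: rE; rewrite inE pr orbT.
by apply: ra; rewrite inE pr orbT.
Qed.

(** The premise on differences is the one that [disjoint_pair] refutes, by taking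
    for [r] a separator that makes [mixed T r] left regular. *)
Lemma mixed_annihilating :
    (forall z w : kU, supported K z -> supported K w -> annihilating z ->
      annihilating w -> annihilating (z - w)) ->
  forall r T, T != [::] -> uniq (map fst r ++ T) ->
    {subset T <= E} -> {subset map fst r <= E} ->
    {subset map snd r <= msupp alpha} -> annihilating (mixed T r).
Proof.
move=> sub_ann; elim=> [|[e h] r IHr] T T0 /= + TE rE ra.
  by move=> _; rewrite mixed_nil; exact: annihilating_diag.
move=> /andP[]; rewrite mem_cat negb_or => /andP[er eT] urT.
have rE' : {subset map fst r <= E} by move=> p pr; apply: rE; rewrite inE pr orbT.
have ra' : {subset map snd r <= msupp alpha}.
  by move=> p pr; apply: ra; rewrite inE pr orbT.
have eE : e \in E by apply: rE; rewrite mem_head.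
have ha : h \in msupp alpha by apply: ra; rewrite mem_head.
have eTE : {subset e :: T <= E} by move=> p; rewrite inE => /predU1P[->|/TE].
have uT : uniq T by move: urT; rewrite cat_uniq => /and3P[].
have ueT : uniq (e :: T) by rewrite /= eT.
rewrite mixed_cons //; apply: sub_ann.
- exact: mixed_supported.
- apply: supportedM => //; last exact: mixed_supported.
  by apply: supported_mono; exact: diagK.
- apply: IHr => //.
  by rewrite -cat1s uniq_catCA cat1s /= mem_cat negb_or er eT.
- have [c c0 rc0] := IHr T T0 urT TE rE' ra'.
  by exists c; [exact: c0|rewrite -mulrA rc0 mulr0].
Qed.

(** As many positions as support elements: one is for [T], the others separate
    [g0] from the remaining elements [gs] of the support. *)
Lemma disjoint_pair : uniq E -> size E = #|` msupp alpha| ->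
  exists a b : kU, [/\ supported K a, supported K b, a != 0, b != 0 &
    forall u v, a * u + b * v = 0 -> a * u = 0].
Proof.
case supp_alpha : (msupp alpha : seq H) => [|g0 gs].
  have /galg_neq0P[x] := alpha_neq0.
  by rewrite mcoeff_neq0 -[_ \in _]/(_ \in (msupp alpha : seq H)) supp_alpha.
move=> uE szE.
case: E uE szE diagK mixed_supported mixed_annihilating => [|e es] //.
move=> /= /andP[ees ues] [sz] _ mix_supp mix_ann.
have fst_zip : map fst (zip es gs) = es by rewrite -/unzip1 unzip1_zip ?sz.
have snd_zip : map snd (zip es gs) = gs by rewrite -/unzip2 unzip2_zip ?sz.
have [z [w [[zK wK za wa] zw]]] : exists z w : kU, [/\ supported K z, supported K w,
    annihilating z & annihilating w] /\ ~ annihilating (z - w).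
  apply: contrapT => none.
  have [|//|||||c c0 rc0] := mix_ann _ (zip es gs) [:: e].
  - move=> z w zK wK za wa; apply: contrapT => nzw; apply: none.
    exact: (ex_intro _ z (ex_intro _ w (conj (And4 zK wK za wa) nzw))).
  - by rewrite fst_zip cats1 rcons_uniq ees.
  - by move=> p; rewrite !inE => ->.
  - by move=> p; rewrite fst_zip inE => ->; rewrite orbT.
  - move=> p; rewrite snd_zip => pgs.
    by rewrite -[_ \in _]/(_ \in (msupp alpha : seq H)) supp_alpha inE pgs orbT.
  - by move/(mixed_regular supp_alpha sz)/eqP: rc0; rewrite (negPf c0).
have [a [aK a0 za0]] : exists a : kU, [/\ supported K a, a != 0 & z * a = 0].
  by have [c] := za; exact: annihilator_restrict.
have [b [bK b0 wb0]] : exists b : kU, [/\ supported K b, b != 0 & w * b = 0].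
  by have [c] := wa; exact: annihilator_restrict.
exists a, b; split; [exact: aK|exact: bK|exact: a0|exact: b0|].
exact: annihilators_disjoint (not_annihilating zw) za0 wb0.
Qed.

End Blocks.

(** * A finitely generated group with infinite uniform dimension *)

Section Lamplighter.
Variables (k : fieldType) (H : groupType) (alpha beta : group_algebra k H).
Hypothesis tfH : torsion_free H.
Hypothesis alpha_neq0 : alpha != 0.
Hypothesis beta_neq0 : beta != 0.
Hypothesis alpha_beta : alpha * beta = 0.
Variable x0 : H.
Hypothesis x0_neq1 : x0 != 1%g.
Local Notation U := (wreath H).

Definition lamplighter_gens : seq U :=
  top x0 :: [seq diag [:: 1%g] g | g <- msupp alpha].

Local Notation S := (generated lamplighter_gens).

Definition positions (m n : nat) : seq H :=
  [seq (x0 ^+ i)%g | i <- index_iota m n].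

Lemma positions_uniq m n : uniq (positions m n).
Proof.
rewrite map_inj_uniq ?iota_uniq //; exact: torsion_free_expg_inj.
Qed.

Lemma mem_positions m n i : ((x0 ^+ i)%g \in positions m n) = (m <= i < n)%N.
Proof.
rewrite mem_map ?mem_index_iota //; exact: torsion_free_expg_inj.
Qed.

Lemma positions_disjoint m n m' n' : (n <= m')%N ->
  {in positions m n, forall p, p \notin positions m' n'}.
Proof.
move=> nm' _ /mapP[i + ->]; rewrite mem_index_iota mem_positions.
move=> /andP[_ lt_in]; rewrite negb_and -ltnNge.
by rewrite (leq_trans lt_in nm').
Qed.

(** Conjugation by [top x0] shifts the positions. *)
Lemma diag_generated i g : g \in msupp alpha -> diag [:: x0 ^+ i]%g g \in S.
Proof.
move=> ga; have S_closed := generated_closed lamplighter_gens.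
have topS : top x0 \in S by apply: mem_generated; rewrite mem_head.
elim: i => [|i IHi].
  by apply: mem_generated; rewrite inE map_f ?orbT.
have -> : diag [:: x0 ^+ i.+1]%g g = (top x0 * diag [:: x0 ^+ i] g * (top x0)^-1)%g.
  rewrite -[diag [:: _] g in RHS](_ : (top x0)^-1 * diag [:: x0 ^+ i.+1] g * top x0 = _)%g.
    by rewrite !mulgA mulgV mul1g mulgK.
  by rewrite top_conj expgS mulKg.
by apply: S_closed.2 => //; exact: group_closedM.
Qed.

Let M := #|` msupp alpha|.

(** The part of the generated group with support in the [n]-th block of [M]
    consecutive positions. *)
Definition block n : {pred U} :=
  [pred u | (u \in base_on (mem (positions (n * M) (n.+1 * M)))) && (u \in S)].

Lemma block_closed n : group_closed (block n).
Proof.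
have [b1 bV] := @base_on_closed H (mem (positions (n * M) (n.+1 * M))).
have [s1 sV] := generated_closed lamplighter_gens.
split; first by apply/andP; split.
move=> u v /andP[ub us] /andP[vb vs].
by apply/andP; split; [exact: bV|exact: sV].
Qed.

Lemma block_pair n : exists ab : group_algebra k U * group_algebra k U,
  [/\ supported (block n) ab.1, supported (block n) ab.2,
      ab.1 != 0, ab.2 != 0 &
      forall u v, ab.1 * u + ab.2 * v = 0 -> ab.1 * u = 0].
Proof.
have [|||a [b abP]] := @disjoint_pair k H alpha beta tfH alpha_neq0 beta_neq0
  alpha_beta (block n) (positions (n * M) (n.+1 * M)) (block_closed n).
- move=> e g eE ga; apply/andP; split.
    by apply: diag_base => p; rewrite inE => /eqP ->.
  by case/mapP: eE => i _ ->; exact: diag_generated.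
- exact: positions_uniq.
- by rewrite size_map size_iota mulSn addnK.
by exists (a, b).
Qed.

Lemma block_commute l j a b : (l < j)%N ->
  supported (block l) a -> supported (block j) b -> a * b = b * a :> group_algebra k U.
Proof.
move=> lj; apply: supported_comm => x y /andP[xl _] /andP[yj _].
apply: base_on_comm xl yj; apply: positions_disjoint.
by rewrite leq_mul2r lj orbT.
Qed.

(** The independent elements are built in the group algebra of the whole wreath
    product, where all copies of [H] are available.  They are supported on the
    generated group, and independence passes to its group algebra. *)
Lemma lamplighter_infinite_dimension :
  infinite_right_uniform_dimension
    (group_algebra k (generated_group lamplighter_gens)).
Proof.
have [ab abP] := choice block_pair.
pose a n := (ab n).1; pose b n := (ab n).2.
have aK n : supported (block n) (a n) by have [] := abP n.
have bK n : supported (block n) (b n) by have [] := abP n.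
have S_closed := generated_closed lamplighter_gens.
have inS n c : supported (block n) c -> @supported k U S c.
  by move=> cK u /cK /andP[].
pose below n : {pred U} := base_on (mem (positions 0 (n * M))).
have prod_below n : supported (below n) (\prod_(l < n) b l) /\
    \prod_(l < n) b l != 0.
  elim: n => [|n [IHs IH0]].
    rewrite big_ord0 oner_neq0; split=> //; apply: supported1.
    exact: (base_on_closed _).1.
  have bn0 : b n != 0 by have [] := abP n.
  rewrite big_ord_recr /=; split.
    apply: supportedM; first exact: base_on_closed.
      move=> u /IHs; apply: base_onS => p /mapP[i + ->].
      rewrite mem_index_iota /= mem_positions => lt_in.
      by rewrite (leq_trans lt_in) // leq_mul2r leqnSn orbT.
    move=> u /bK /andP[+ _]; apply: base_onS => p /mapP[i + ->].
    by rewrite mem_index_iota /= mem_positions => /andP[_ ->].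
  apply: mul_neq0_disjoint IHs (bK n) IH0 bn0.
  - exact: base_on_closed.
  - exact: block_closed.
  - move=> u uB /andP[uK _]; apply: base_on_disjoint uB uK.
    exact: positions_disjoint.
have stair_neq0 n : staircase a b n != 0.
  have [Ps P0] := prod_below n; have an0 : a n != 0 by have [] := abP n.
  apply: mul_neq0_disjoint Ps (aK n) P0 an0.
  - exact: base_on_closed.
  - exact: block_closed.
  - move=> u uB /andP[uK _]; apply: base_on_disjoint uB uK.
    exact: positions_disjoint.
have stair_supp n : supported S (staircase a b n).
  apply: supportedM => //; last exact: inS (aK n).
  elim: n => [|n IHn]; first by rewrite big_ord0; apply: supported1; exact: S_closed.1.
  by rewrite big_ord_recr; apply: supportedM => //; exact: inS (bK n).
pose G := generated_group lamplighter_gens.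
pose v : G -> U := @subgroup_val _ _ (generated_closed lamplighter_gens).
have v_inj : injective v by exact: subgroup_val_inj.
have vM : {morph v : x y / (x * y)%g} by exact: subgroup_valM.
have v_surj y : y \in S -> exists x, v x = y by exact: subgroup_val_surj.
have [x xP] := choice (fun n => push_surj (stair_supp n) v_surj).
apply: (@infinite_dimension_of_independent (group_algebra k G) x).
  move=> n; apply: contra (stair_neq0 n) => /eqP xn0.
  by rewrite -(xP n) xn0 push0.
move=> n u sum0 i lt_in; apply: (push_inj v_inj).
rewrite (pushM vM) push0 xP.
apply: (@staircase_independent _ a b _ _ _ n (fun j => push v (u j))) lt_in.
- by move=> l j lj; exact: block_commute (bK l) (aK j).
- by move=> l j lj; exact: block_commute (bK l) (bK j).
- by move=> j; have [] := abP j.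
rewrite -[RHS](push0 k v) -sum0 push_sum; apply: eq_bigr => j _.
by rewrite (pushM vM) xP.
Qed.

End Lamplighter.

Theorem proposition1p5 (R : realType) (k : fieldType) (H : groupType) :
  torsion_free H -> amenable R H -> ~ is_domain (group_algebra k H) ->
  exists G : groupType,
    [/\ finitely_generated G, torsion_free G, amenable R G &
        infinite_right_uniform_dimension (group_algebra k G)].
Proof.
move=> tfH amH ndom.
have [alpha [beta [alpha0 beta0 ab0]]] : exists alpha beta : group_algebra k H,
    [/\ alpha != 0, beta != 0 & alpha * beta = 0].
  apply: contrapT => none; apply: ndom => a b ab0.
  have [//|a0] := eqVneq a 0; have [//|b0] := eqVneq b 0.
  by case: none; exists a, b.
(* over the trivial group the group algebra is the field k *)
have [x0 x0_neq1] : exists x0 : H, x0 != 1%g.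
  apply: contrapT => triv.
  have H1 (x : H) : x = 1%g.
    by apply/eqP; apply: contrapT => /negP x1; apply: triv; exists x.
  have [x ax] := galg_neq0P _ alpha0; have [y bx] := galg_neq0P _ beta0.
  have galg1 (c : group_algebra k H) : c = mono c@_1%g 1%g.
    by apply/galgP => z; rewrite coeff_mono (H1 z) eqxx.
  move: ab0; rewrite (galg1 alpha) (galg1 beta) monoM => /galgP/(_ 1%g)/eqP.
  rewrite coeff_mono mulg1 eqxx coeff0 mulf_eq0.
  by rewrite (H1 x) in ax; rewrite (H1 y) in bx; rewrite (negPf ax) (negPf bx).
exists (generated_group (lamplighter_gens alpha x0)); split.
- exact: generated_group_fg.
- apply: (torsion_free_morph (@subgroup_valM _ _ _) (@subgroup_val_inj _ _ _)).
  exact: torsion_free_wreath.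
- apply: wreath_subgroup_amenable => // u; rewrite inE => /predU1P[->|].
    by right; exists x0.
  by move=> /mapP[g _ ->]; left; exists 1%g, g.
- exact: lamplighter_infinite_dimension ab0 _ x0_neq1.
Qed.
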